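(* Let $\mu:\mathcal{P}(\mathcal{C})\to L^*$ be a capacity and $f:\mathcal{C}\to L^*$ an input vector. Then $\int_{\mathrm{DPR},\mu}^{\to_D} f>_\ell *$ if and only if $\mu^c(\{i\in\mathcal{C}\mid f_i=0\})=0$ and $\mu^c(\{i\in\mathcal{C}\mid f_i\le_\ell *\})<_\ell 1$.
   Context: Residuated lattice: $L=(L,\wedge,\vee,\otimes,\to,0,1)$ is a linearly ordered residuated lattice: $(L,\wedge,\vee,0,1)$ is a linearly ordered lattice with bottom $0$ and top $1$ ($0\neq 1$), $(L,\otimes,1)$ is a commutative monoid, and $\alpha\otimes\beta\le\gamma$ iff $\alpha\le\beta\to\gamma$. The underlying ordered set of $L$ is either a closed real interval $[a,b]$ with $a<b$ or a finite subset of $[a,b]$ containing $a$ and $b$ (with $0,1$ denoting the bottom and top elements). Standing assumption: $L$ has no zero divisors with respect to $\otimes$, i.e. $\alpha\otimes\beta=0$ implies $\alpha=0$ or $\beta=0$. Dragonfly algebra: $L^*=L\cup\{*\}$ with $*\notin L$ (the ''unknown value''). Its linear order $\le_\ell$ extends the order of $L$ by $0<_\ell *<_\ell\alpha$ for all $\alpha\in L\setminus\{0\}$; $\wedge_D,\vee_D$ are the minimum and maximum with respect to $\le_\ell$, and $\bigwedge_D,\bigvee_D$ denote infimum and supremum with respect to $\le_\ell$ (with $\bigwedge_D\emptyset=1$, $\bigvee_D\emptyset=0$). The residuum $\to_D$ on $L^*$ is: $\alpha\to_D\beta=\alpha\to\beta$ for $\alpha,\beta\in L$; $\alpha\to_D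 *=*$ for $\alpha\in L\setminus\{0\}$; $0\to_D *=1$; $*\to_D *=1$; $*\to_D 0=*$; $*\to_D\beta=\beta$ for $\beta\in L\setminus\{0\}$. $\mathcal{C}=\{1,\dots,n\}$ is a finite non-empty set with power set $\mathcal{P}(\mathcal{C})$. An input vector is a map $f:\mathcal{C}\to L^*$, $f_i=f(i)$. A capacity is a map $\mu:\mathcal{P}(\mathcal{C})\to L^*$ with $\mu(\emptyset)=0$, $\mu(\mathcal{C})=1$, and $A\subseteq B\Rightarrow\mu(A)\le_\ell\mu(B)$. Put $\mu^c(A)=\mu(\mathcal{C}\setminus A)\to_D 0$. The residuum-based qualitative integral is $$\int_{\mathrm{DPR},\mu}^{\to_D} f=\bigwedge_{D,\,A\subseteq\mathcal{C}}\Big(\mu^c(A)\to_D\bigvee_{D,\,i\in A}f_i\Big).$$ *)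

(* Defs.v *)
From HB Require Import structures.
From mathcomp Require Import all_boot all_order all_algebra.
From mathcomp Require Import all_classical reals.

Set Implicit Arguments.
Unset Strict Implicit.
Unset Printing Implicit Defensive.

Import Order.TTheory.
Local Open Scope order_scope.
Local Open Scope classical_set_scope.

(* The lattice part (meet, join, 0 = \bot, 1 = \top) of a linearly ordered
   residuated lattice is that of tbOrderType; otimes and resid are the monoid
   operation and its residuum. *)
HB.mixin Record isResiduatedChain d L of Order.TBTotal d L := {
  otimes : L -> L -> L;
  resid : L -> L -> L;
  otimesA : associative otimes;
  otimesC : commutative otimes;
  otimes1x : left_id (\top : L) otimes;
  residP : forall x y z : L, (otimes x y <= z) = (x <= resid y z);
  bot_neq_top : (\bot : L) != \top
}.

#[short(type="residuatedChainType")]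
HB.structure Definition ResiduatedChain d :=
  { L of isResiduatedChain d L & Order.TBTotal d L }.

Definition no_zero_divisors d (L : residuatedChainType d) : Prop :=
  forall x y : L, otimes x y = \bot -> x = \bot \/ y = \bot.

(* The ordered set L is, through the order embedding v, a closed interval
   [a, b] of reals or a finite subset of [a, b] containing a and b. *)
Definition real_chain (R : realType) d (L : porderType d) : Prop :=
  exists (v : L -> R) (a b : R),
    [/\ a < b,
        {mono v : x y / x <= y} &
        range v = [set` `[a, b]] \/
        [/\ finite_set (range v), range v `<=` [set` `[a, b]],
            range v a & range v b]].

(* L^* = L + {*} *)
Inductive dragonfly (L : Type) := Known of L | Star.
Arguments Star {L}.

Section DragonflyOrder.
Variables (d : Order.disp_t) (L : residuatedChainType d).

Definition option_of_dragonfly (x : dragonfly L) : option L :=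
  if x is Known a then Some a else None.
Definition dragonfly_of_option (x : option L) : dragonfly L :=
  if x is Some a then Known a else Star.
Fact option_of_dragonflyK : cancel option_of_dragonfly dragonfly_of_option.
Proof. by case. Qed.

HB.instance Definition _ :=
  Choice.copy (dragonfly L) (can_type option_of_dragonflyK).

(* 0 < * < a for every a in L \ {0} *)
Definition leD (x y : dragonfly L) : bool :=
  match x, y with
  | Known a, Known b => a <= b
  | Known a, Star => a == \bot
  | Star, Known b => b != \bot
  | Star, Star => true
  end.

Fact leD_refl : reflexive leD.
Proof. by case=> /=. Qed.

Fact leD_anti : antisymmetric leD.
Proof.
case=> [a|] [b|] //=; first by move/le_anti->.
- by case/andP=> ->.
- by case/andP=> /negPf->.
Qed.

Fact leD_trans : transitive leD.
Proof.
case=> [b|] [a|] [c|] //=.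
- exact: le_trans.
- by move=> ab /eqP b0; rewrite -lex0 -b0.
- by rewrite -!lt0x; apply: lt_le_trans.
- by move/eqP->; rewrite le0x.
Qed.

Fact leD_total : total leD.
Proof.
case=> [a|] [b|] //=; first exact: le_total.
- exact: orbN.
- exact: orNb.
Qed.

HB.instance Definition _ :=
  Order.Le_isPOrder.Build d (dragonfly L) leD_refl leD_anti leD_trans.

HB.instance Definition _ :=
  Order.POrder_isTotal.Build d (dragonfly L) leD_total.

Fact leD0x (x : dragonfly L) : leD (Known \bot) x.
Proof. by case: x => [a|] //=; rewrite le0x. Qed.

HB.instance Definition _ :=
  Order.hasBottom.Build d (dragonfly L) leD0x.

Fact leDx1 (x : dragonfly L) : leD x (Known \top).
Proof. by case: x => [a|] /=; rewrite ?lex1 // eq_sym bot_neq_top. Qed.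

HB.instance Definition _ :=
  Order.hasTop.Build d (dragonfly L) leDx1.

Definition residD (x y : dragonfly L) : dragonfly L :=
  match x, y with
  | Known a, Known b => Known (resid a b)
  | Known a, Star => if a == \bot then Known \top else Star
  | Star, Star => Known \top
  | Star, Known b => if b == \bot then Star else Known b
  end.

Variable n : nat.
Implicit Types (mu : {set 'I_n} -> dragonfly L) (f : 'I_n -> dragonfly L).

Definition capacity mu : Prop :=
  [/\ mu finset.set0 = Known \bot, mu [set: 'I_n]%SET = Known \top &
      forall A B : {set 'I_n}, A \subset B -> mu A <= mu B].

Definition conj_capacity mu (A : {set 'I_n}) : dragonfly L :=
  residD (mu (~: A)%SET) (Known \bot).

(* The empty meet and join are \top = Known \top and \bot = Known \bot. *)
Definition DPR_integral mu f : dragonfly L :=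
  \meet_(A : {set 'I_n}) residD (conj_capacity mu A) (\join_(i in A) f i).

End DragonflyOrder.

(* Main.v *)
Require Import Defs.
From HB Require Import structures.
From mathcomp Require Import all_boot all_order all_algebra.
From mathcomp Require Import all_classical reals.

(** Without zero divisors the pseudo-complement [a -> 0] is [1] at [a = 0] and
    [0] elsewhere, so the conjugate capacity only takes the values [0], [*] and
    [1] ([conj_capacity_cases]).  For such a value [c], the residuum of [c] and
    [b] lies above [*] exactly when [b = 0] forces [c = 0] and [b <= *] forces
    [c < 1] ([lt_Star_residD]).

    In a finite chain the integral exceeds [*] iff every term does, that is, iff
    the conjugate capacity is [0] on each [A] over which the join of [f]
    vanishes and below [1] on each [A] over which this join is at most [*].
    These two families consist of the subsets of [{f = 0}] and of [{f <= *}];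
    as the conjugate capacity is monotone ([conj_capacity_mono]), it is enough
    to test the largest member of each. *)

Set Implicit Arguments.
Unset Strict Implicit.
Unset Printing Implicit Defensive.

Import Order.TTheory.
Local Open Scope order_scope.

(** Totality makes strict bounds pass to finite meets; [x < \top] covers the
    empty meet. *)
Lemma lt_meets d (T : tbOrderType d) (I : finType) (x : T) (F : I -> T) :
  x < \top -> (x < \meet_i F i) <-> (forall i, x < F i).
Proof.
move=> x1; split=> [xF i|xF]; first exact: lt_le_trans xF (meets_inf _ _).
by elim/big_ind: _ => // y z xy xz; rewrite ltxI xy.
Qed.

Section Theory.
Context {d : Order.disp_t} {L : residuatedChainType d}.
Implicit Types (a : L) (b c x y : dragonfly L).

Lemma bot_resid a : resid \bot a = \top.
Proof. by apply/eqP; rewrite -le1x -residP otimes1x le0x. Qed.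

Lemma top_resid a : resid \top a = a.
Proof.
apply/le_anti/andP; split.
  by rewrite -[X in X <= _]otimes1x otimesC residP.
by rewrite -residP otimesC otimes1x.
Qed.

(** For [a != 0] the elements [a -> 0] and [a] have product [0], so the absence
    of zero divisors forces [a -> 0] to vanish. *)
Lemma resid_bot a :
  no_zero_divisors L -> resid a \bot = if a == \bot then \top else \bot.
Proof.
move=> nzd; case: eqVneq => [->|a0]; first exact: bot_resid.
have: otimes (resid a \bot) a = \bot by apply/eqP; rewrite -lex0 residP.
by case/nzd => // /eqP; rewrite (negPf a0).
Qed.

Lemma Star_lt_Known a : ((Star : dragonfly L) < Known a) = (a != \bot).
Proof. by rewrite ltNge /Order.le /=. Qed.

(** Splits the condition on a term of the integral into one constraint for
    [b = 0] and one for [b <= *], each stable under lowering [c].  The formula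
    fails for a known [c] strictly between [0] and [1], since the residuum of
    such a [c] and [*] is [*]. *)
Lemma lt_Star_residD c b : [\/ c = Known \bot, c = Star | c = Known \top] ->
  (Star < residD c b) =
  ((b == Known \bot) ==> (c == Known \bot)) &&
  ((b <= Star) ==> (c < Known \top)).
Proof.
have t0 : (\top == \bot :> L) = false by rewrite eq_sym; apply/negbTE/bot_neq_top.
have K01 : ((Known \bot : dragonfly L) < Known \top).
  by rewrite ltNge /Order.le /= lex0 t0.
have S1 : (Star : dragonfly L) < Known \top by rewrite Star_lt_Known t0.
have KE a' : ((Known a' : dragonfly L) == Known \bot) = (a' == \bot).
  by apply/eqP/eqP => [[]|->].
case=> ->; rewrite ?KE ?t0 ?K01 ?S1 ?ltxx ?eqxx !(implybT, implybF) //=.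
- by case: b => [a|] /=; rewrite ?bot_resid ?eqxx.
- case: b => [a|] /=; last by rewrite S1.
  rewrite KE andbT; case: (eqVneq a \bot) => [_|a0]; first by rewrite ltxx.
  by rewrite Star_lt_Known a0.
case: b => [a|] /=; last by rewrite t0 ltxx.
by rewrite top_resid KE -ltNge Star_lt_Known andbb.
Qed.

Section Conjugate.
Context {n : nat} (mu : {set 'I_n} -> dragonfly L).
Hypothesis nzd : no_zero_divisors L.

Lemma conj_capacity_cases (A : {set 'I_n}) :
  [\/ conj_capacity mu A = Known \bot, conj_capacity mu A = Star
    | conj_capacity mu A = Known \top].
Proof.
rewrite /conj_capacity; case: (mu _) => [a|] /=.
  by rewrite resid_bot //; case: ifP => _; [constructor 3|constructor 1].
by rewrite eqxx; constructor 2.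
Qed.

Lemma residD_bot_anti x y :
  x <= y -> residD y (Known \bot) <= residD x (Known \bot).
Proof.
rewrite /Order.le /=; case: x y => [a|] [b|] //=; rewrite ?eqxx //=.
- rewrite !resid_bot //; case: (eqVneq b \bot) => [->|_]; last by rewrite le0x.
  by rewrite lex0 => ->.
- by move=> a0; rewrite resid_bot // a0 eq_sym bot_neq_top.
- by move=> b0; rewrite resid_bot // (negPf b0).
Qed.

(** Complementation and [residD _ 0] both reverse the order. *)
Lemma conj_capacity_mono (A B : {set 'I_n}) :
  capacity mu -> A \subset B -> conj_capacity mu A <= conj_capacity mu B.
Proof.
by case=> _ _ mono AB; apply/residD_bot_anti/mono; rewrite finset.setCS.
Qed.

End Conjugate.
End Theory.

Theorem theorem7 (R : realType) (d : Order.disp_t) (L : residuatedChainType d)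
    (n : nat) (mu : {set 'I_n} -> dragonfly L) (f : 'I_n -> dragonfly L) :
  real_chain R L -> no_zero_divisors L -> (0 < n)%N -> capacity mu ->
  (Star < DPR_integral mu f)%O <->
    conj_capacity mu [set i | f i == Known \bot%O]%SET = Known \bot%O /\
    (conj_capacity mu [set i | (f i <= Star)%O]%SET < Known \top%O)%O.
Proof.
move=> _ nzd _ cap; set Z := [set i | _ == _]%SET; set S := [set i | _ <= _]%SET.
have join0 (A : {set 'I_n}) : (\join_(i in A) f i == Known \bot) = (A \subset Z).
  rewrite -[_ == _]lex0; apply/joinsP/fintype.subsetP => fA i /fA.
    by rewrite lex0 inE.
  by rewrite inE => /eqP->.
have joinS (A : {set 'I_n}) : (\join_(i in A) f i <= Star) = (A \subset S).
  by apply/joinsP/fintype.subsetP => fA i /fA; rewrite inE.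
have S1 : (Star : dragonfly L) < \top.
  by rewrite Star_lt_Known eq_sym bot_neq_top.
have termE (A : {set 'I_n}) :=
  lt_Star_residD (\join_(i in A) f i) (conj_capacity_cases mu nzd A).
apply: (iff_trans (lt_meets _ S1)); split=> [terms|[Z0 lt1] A].
  split.
    move: (terms Z); rewrite termE join0 subxx => /andP[] /=.
    by move=> /eqP.
  by move: (terms S); rewrite termE joinS subxx => /andP[].
rewrite termE join0 joinS; apply/andP; split; apply/implyP => sA.
  by rewrite -[_ == _]lex0 -[X in _ <= X]Z0 conj_capacity_mono.
exact: le_lt_trans (conj_capacity_mono nzd cap sA) lt1.
Qed.
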